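(* Let $h$ be a fixed positive integer and let $$S(x;h):=\sum_{1\le n\le x,\ n\neq h} d(n)\,d(n-h)\,d(n+h).$$ Then, as $x\to\infty$, $$S(x;h)\ \ge\ \frac{c_h}{27}\,x(\log x)^3+O_h\big(x(\log x)^2\big),$$ where $$c_h:=\frac{11}{8}\,f(h)\prod_{p}\Big(1-\frac1p\Big)^2\Big(1+\frac2p\Big),$$ the product running over all primes $p$, and $f$ is the multiplicative function with $f(1)=1$ and, for primes $p$ and integers $\nu\ge1$, $$f(p^\nu)=\begin{cases}\left(1+\frac4p+\frac1{p^2}-\frac{3\nu+4}{p^{\nu+1}}-\frac4{p^{\nu+2}}+\frac{3\nu+2}{p^{\nu+3}}\right)\left(1+\frac2p\right)^{-1}\left(1-\frac1p\right)^{-2}, & p>2,\\[2mm] \frac{52}{11}-\frac{41+15\nu}{11\cdot 2^{\nu}}, & p=2.\end{cases}$$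
   Context: For a nonzero integer $m$, $d(m)$ denotes the number of positive divisors of $m$ (so $d(m)=d(|m|)$). The implied constant in $O_h$ may depend on $h$. *)

(* Defs.v *)
From Stdlib Require Import Reals.
From Coquelicot Require Import Coquelicot.
From mathcomp Require Import ssreflect ssrfun ssrbool eqtype ssrnat seq div prime bigop.

Definition dnum (m : nat) : nat := size (divisors m).

(* S(x;h) = sum_{1 <= n <= x, n <> h} d(n) d(|n-h|) d(n+h) *)
Definition Ssum (h : nat) (x : R) : nat :=
  \sum_(1 <= n < (Z.to_nat (Int_part x)).+1 | n != h)
     dnum n * dnum ((n - h) + (h - n)) * dnum (n + h).

Definition fpp (p nu : nat) : R :=
  if nu == 0%N then 1%R
  else if p == 2%N then
    (52 / 11 - (41 + 15 * INR nu) / (11 * 2 ^ nu))%R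
  else
    let q := INR p in
    ((1 + 4 / q + 1 / q ^ 2 - (3 * INR nu + 4) / q ^ (nu + 1)
        - 4 / q ^ (nu + 2) + (3 * INR nu + 2) / q ^ (nu + 3))
     / (1 + 2 / q) / (1 - 1 / q) ^ 2)%R.

Definition fmul (n : nat) : R :=
  \big[Rmult/1%R]_(0 <= p < n.+1 | prime p) fpp p (logn p n).

Definition euler_partial (N : nat) : R :=
  \big[Rmult/1%R]_(0 <= p < N | prime p)
     ((1 - 1 / INR p) ^ 2 * (1 + 2 / INR p))%R.

Definition euler_prod : R := real (Lim_seq euler_partial).

Definition c_h (h : nat) : R := (11 / 8 * fmul h * euler_prod)%R.

(* Main.v *)
Require Import Defs.
From HB Require Import structures.
From Stdlib Require Import ZArith Reals Lra Lia.
From Coquelicot Require Import Coquelicot.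
From mathcomp Require Import ssreflect ssrfun ssrbool eqtype ssrnat seq div prime bigop.
From mathcomp Require Import zify.

Set Implicit Arguments.
Unset Strict Implicit.
Unset Printing Implicit Defensive.

Local Open Scope R_scope.

(** Only divisors up to [y = x^(1/3)] are kept: [S(x;h)] is at least the sum over [a, b, c <= y]
    of the number of [n] with [h < n <= x], [a | n], [b | n - h], [c | n + h], which is
    [x / lcm(a,b,c) + O(1)] when the congruences are compatible.  As [y^3 <= x], the errors
    contribute [O(x)], and it remains to bound from below the sum of the densities.

    Such a density is [1/(abc)] times a product over primes [p] of a function of the valuations
    of [a, b, c].  Each local function is a finite combination of step functions
    [i' <= i, j' <= j, k' <= k], so inserting one prime turns the triple sum into a
    combination of dilated sums [F(s/p^i', t/p^j', r/p^k')].  An induction on the primes then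
    starts from a product of three harmonic sums and shows that the sum over [a, b, c <= y]
    with the conditions at primes below [N] is [K_N (log y)^3 + O((log y)^2)] uniformly in [N];
    the dilations cost a factor [(abc)^(1/4)], which keeps the product over the primes of the
    error factors convergent.  Finally [K_N] decreases to [c_h], whence the lower bound. *)

HB.instance Definition _ := Monoid.isComLaw.Build R 0 Rplus
  (fun x y z => esym (Rplus_assoc x y z)) Rplus_comm Rplus_0_l.
HB.instance Definition _ := Monoid.isComLaw.Build R 1 Rmult
  (fun x y z => esym (Rmult_assoc x y z)) Rmult_comm Rmult_1_l.
HB.instance Definition _ := Monoid.isMulLaw.Build R 0 Rmult Rmult_0_l Rmult_0_r.
HB.instance Definition _ := Monoid.isAddLaw.Build R Rmult Rplus
  (fun x y z => Rmult_plus_distr_r x y z) (fun x y z => Rmult_plus_distr_l x y z).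

(** * Finite real sums *)

Notation "\rsum_ ( i <- r ) F" := (\big[Rplus/0]_(i <- r) F)
  (at level 41, F at level 41, i, r at level 50).
Notation "\rsum_ ( m <= i < n ) F" := (\big[Rplus/0]_(m <= i < n) F)
  (at level 41, F at level 41, i, m, n at level 50).

Lemma rsum_le (I : eqType) (r : seq I) (F G : I -> R) :
  (forall i, i \in r -> F i <= G i) -> \rsum_(i <- r) F i <= \rsum_(i <- r) G i.
Proof.
elim: r => [|i r IH] H; rewrite ?big_nil ?big_cons; first by lra.
apply: Rplus_le_compat; first by apply: H; rewrite mem_head.
by apply: IH => j jr; apply: H; rewrite in_cons jr orbT.
Qed.

Lemma rsum_abs_sub_le (I : Type) (r : seq I) (F G B : I -> R) :
  (forall i, Rabs (F i - G i) <= B i) ->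
  Rabs (\rsum_(i <- r) F i - \rsum_(i <- r) G i) <= \rsum_(i <- r) B i.
Proof.
move=> H; elim: r => [|i r IH]; rewrite ?big_nil ?big_cons.
  by rewrite Rminus_diag Rabs_R0; lra.
have := H i; move: IH; split_Rabs; lra.
Qed.

Lemma rprod_ge0 (r : seq nat) (P : pred nat) (F : nat -> R) :
  (forall i, P i -> 0 <= F i) -> 0 <= \big[Rmult/1]_(i <- r | P i) F i.
Proof.
move=> H; apply: big_ind => //; first by lra.
by move=> x y; apply: Rmult_le_pos.
Qed.

Lemma INR_sum (I : Type) (r : seq I) (F : I -> nat) :
  INR (\sum_(i <- r) F i) = \rsum_(i <- r) INR (F i).
Proof. exact: (big_morph INR plus_INR). Qed.

Lemma INR_expn (p i : nat) : INR (p ^ i) = INR p ^ i.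
Proof. by elim: i => [|i IH]; rewrite ?expnS ?mult_INR ?IH. Qed.

Definition ind (b : bool) : R := if b then 1 else 0.

Lemma rsum_dvdn (s d : nat) (phi : nat -> R) : (0 < d)%N ->
  \rsum_(1 <= a < s.+1) (ind (d %| a) * phi a) =
  \rsum_(1 <= a < (s %/ d).+1) phi (d * a)%N.
Proof.
move=> d0; elim: s => [|s IH]; first by rewrite div0n !big_nil.
rewrite big_nat_recr //= IH; case: (boolP (d %| s.+1)) => ds /=.
  have -> : (s.+1 %/ d = (s %/ d).+1)%N by rewrite divnS // ds add1n.
  rewrite [in RHS]big_nat_recr //=; congr (_ + _).
  have -> : ((s %/ d).+1 = s.+1 %/ d)%N by rewrite divnS // ds add1n.
  by rewrite mulnC divnK //= Rmult_1_l.
have -> : (s.+1 %/ d = s %/ d)%N by rewrite divnS // (negbTE ds).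
by rewrite /=; lra.
Qed.

Definition sum3 (s t r : nat) (phi : nat -> nat -> nat -> R) : R :=
  \rsum_(1 <= a < s.+1) \rsum_(1 <= b < t.+1) \rsum_(1 <= c < r.+1) phi a b c.

Lemma eq_sum3 s t r phi psi :
  (forall a b c, (0 < a <= s)%N -> (0 < b <= t)%N -> (0 < c <= r)%N ->
     phi a b c = psi a b c) ->
  sum3 s t r phi = sum3 s t r psi.
Proof.
move=> H; apply: eq_big_nat => a Ha; apply: eq_big_nat => b Hb.
by apply: eq_big_nat => c Hc; apply: H.
Qed.

Lemma sum3_le s t r phi psi :
  (forall a b c, (0 < a <= s)%N -> (0 < b <= t)%N -> (0 < c <= r)%N ->
     phi a b c <= psi a b c) ->
  sum3 s t r phi <= sum3 s t r psi.
Proof.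
move=> H; apply: rsum_le => a; rewrite mem_index_iota => Ha.
apply: rsum_le => b; rewrite mem_index_iota => Hb.
by apply: rsum_le => c; rewrite mem_index_iota => Hc; apply: H.
Qed.

Lemma sum3_scal s t r x phi :
  sum3 s t r (fun a b c => x * phi a b c) = x * sum3 s t r phi.
Proof.
rewrite /sum3 big_distrr; apply: eq_bigr => a _; rewrite big_distrr.
by apply: eq_bigr => b _; rewrite big_distrr.
Qed.

Lemma sum3_plus s t r phi psi :
  sum3 s t r (fun a b c => phi a b c + psi a b c) =
  sum3 s t r phi + sum3 s t r psi.
Proof.
rewrite /sum3 -big_split; apply: eq_bigr => a _; rewrite -big_split.
by apply: eq_bigr => b _; rewrite -big_split.
Qed.

Lemma sum3_rsum (I : Type) (T : seq I) s t r (phi : I -> nat -> nat -> nat -> R) :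
  sum3 s t r (fun a b c => \rsum_(u <- T) phi u a b c) =
  \rsum_(u <- T) sum3 s t r (phi u).
Proof.
rewrite /sum3 [RHS]exchange_big; apply: eq_bigr => a _ /=.
rewrite [RHS]exchange_big; apply: eq_bigr => b _ /=.
by rewrite [RHS]exchange_big.
Qed.

Lemma sum3_mul s t r (f g k : nat -> R) :
  sum3 s t r (fun a b c => f a * g b * k c) =
  (\rsum_(1 <= a < s.+1) f a) * (\rsum_(1 <= b < t.+1) g b) *
  (\rsum_(1 <= c < r.+1) k c).
Proof.
rewrite !big_distrl; apply: eq_bigr => a _ /=.
rewrite (big_distrr (f a)) big_distrl.
by apply: eq_bigr => b _; rewrite big_distrr.
Qed.

Lemma sum3_dvdn s t r d e f phi : (0 < d)%N -> (0 < e)%N -> (0 < f)%N ->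
  sum3 s t r (fun a b c => ind (d %| a) * ind (e %| b) * ind (f %| c) * phi a b c) =
  sum3 (s %/ d) (t %/ e) (r %/ f) (fun a b c => phi (d * a) (e * b) (f * c))%N.
Proof.
move=> d0 e0 f0; rewrite /sum3.
rewrite -(rsum_dvdn s (fun a => \rsum_(1 <= b < (t %/ e).+1)
  \rsum_(1 <= c < (r %/ f).+1) phi a (e * b)%N (f * c)%N) d0).
apply: eq_bigr => a _.
rewrite -(rsum_dvdn t (fun b => \rsum_(1 <= c < (r %/ f).+1) phi a b (f * c)%N) e0).
rewrite big_distrr; apply: eq_bigr => b _ /=.
rewrite -(rsum_dvdn r (phi a b) f0) !big_distrr; apply: eq_bigr => c _ /=; lra.
Qed.

(** * Local weights as combinations of steps *)

(** An entry [(i', j', k', x)] is [x] times a product of three steps. Steps are preferred to point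
    masses because, at the valuations of [a], [b], [c], a step says that [p^i'], [p^j'], [p^k']
    divide them, which dilates the triple sum. *)
Definition steps (T : seq (nat * nat * nat * R)) (i j k : nat) : R :=
  \rsum_(u <- T) (u.2 * (ind (u.1.1.1 <= i)%N * ind (u.1.1.2 <= j)%N * ind (u.1.2 <= k)%N)).

(** For [0 < q < 1] this is [(1 - q)^3] times the sum of [q^(i+j+k)] weighted by the step function,
    that is, the Euler factor relative to three harmonic sums. *)
Definition mass (q : R) (T : seq (nat * nat * nat * R)) : R :=
  \rsum_(u <- T) (u.2 * q ^ (u.1.1.1 + u.1.1.2 + u.1.2)).

Definition step_repr (q : R) (theta : nat -> nat -> nat -> R) (kappa : R) : Prop :=
  exists T, (forall i j k, theta i j k = steps T i j k) /\ mass q T = kappa.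

Definition step_repr1 (q : R) (alpha : nat -> R) (kappa : R) : Prop :=
  exists D : seq (nat * R),
    (forall i, alpha i = \rsum_(u <- D) (u.2 * ind (u.1 <= i)%N)) /\
    \rsum_(u <- D) (u.2 * q ^ u.1) = kappa.

Section StepRepr.
Variable q : R.

Lemma step_repr_ext theta theta' kappa kappa' :
  (forall i j k, theta i j k = theta' i j k) -> kappa = kappa' ->
  step_repr q theta kappa -> step_repr q theta' kappa'.
Proof. by move=> H <- [T [HT mT]]; exists T; split=> // i j k; rewrite -H. Qed.

Lemma step_repr_plus theta theta' kappa kappa' :
  step_repr q theta kappa -> step_repr q theta' kappa' ->
  step_repr q (fun i j k => theta i j k + theta' i j k) (kappa + kappa').
Proof.
move=> [T [HT mT]] [T' [HT' mT']]; exists (T ++ T'); split.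
  by move=> i j k; rewrite HT HT' /steps big_cat.
by rewrite -mT -mT' /mass big_cat.
Qed.

Lemma step_repr_scal x theta kappa :
  step_repr q theta kappa -> step_repr q (fun i j k => x * theta i j k) (x * kappa).
Proof.
move=> [T [HT mT]]; exists [seq (u.1, x * u.2) | u <- T]; split.
  move=> i j k; rewrite HT /steps big_map big_distrr.
  by apply: eq_bigr => u _ /=; lra.
by rewrite -mT /mass big_map big_distrr; apply: eq_bigr => u _ /=; lra.
Qed.

Lemma step_repr_mul alpha beta gamma ka kb kc :
  step_repr1 q alpha ka -> step_repr1 q beta kb -> step_repr1 q gamma kc ->
  step_repr q (fun i j k => alpha i * beta j * gamma k) (ka * kb * kc).
Proof.
move=> [A [HA mA]] [B [HB mB]] [C [HC mC]].
exists [seq (u.1, w.1, u.2 * w.2) | u <- [seq (u.1, v.1, u.2 * v.2) | u <- A, v <- B],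
                                    w <- C]; split.
  move=> i j k; rewrite HA HB HC /steps !big_allpairs_dep !big_distrl.
  apply: eq_bigr => u _ /=; rewrite (big_distrr (u.2 * _)) big_distrl.
  apply: eq_bigr => v _ /=; rewrite big_distrr; apply: eq_bigr => w _ /=; lra.
rewrite -mA -mB -mC /mass !big_allpairs_dep !big_distrl.
apply: eq_bigr => u _ /=; rewrite (big_distrr (u.2 * _)) big_distrl.
apply: eq_bigr => v _ /=; rewrite big_distrr; apply: eq_bigr => w _ /=.
rewrite !pow_add; lra.
Qed.

Lemma step_repr1_ext alpha alpha' kappa kappa' :
  (forall i, alpha i = alpha' i) -> kappa = kappa' ->
  step_repr1 q alpha kappa -> step_repr1 q alpha' kappa'.
Proof. by move=> H <- [D [HD mD]]; exists D; split=> // i; rewrite -H. Qed.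

Lemma step_repr1_plus alpha alpha' kappa kappa' :
  step_repr1 q alpha kappa -> step_repr1 q alpha' kappa' ->
  step_repr1 q (fun i => alpha i + alpha' i) (kappa + kappa').
Proof.
move=> [D [HD mD]] [D' [HD' mD']]; exists (D ++ D'); split.
  by move=> i; rewrite HD HD' big_cat.
by rewrite -mD -mD' big_cat.
Qed.

Lemma step_repr1_scal x alpha kappa :
  step_repr1 q alpha kappa -> step_repr1 q (fun i => x * alpha i) (x * kappa).
Proof.
move=> [D [HD mD]]; exists [seq (u.1, x * u.2) | u <- D]; split.
  by move=> i; rewrite HD big_map big_distrr; apply: eq_bigr => u _ /=; lra.
by rewrite -mD big_map big_distrr; apply: eq_bigr => u _ /=; lra.
Qed.

Lemma step_repr1_step n : step_repr1 q (fun i => ind (n <= i)%N) (q ^ n).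
Proof.
by exists [:: (n, 1)]; split=> [i|]; rewrite big_seq1 /= Rmult_1_l.
Qed.

Hypothesis q0 : 0 < q.

(** With [q = 1/p]: [p^i] times the indicator that [p^i] divides an integer of exact valuation
    [e]. *)
Definition trunc_pow (e i : nat) : R := if (i <= e)%N then (/ q) ^ i else 0.

(** With [q = 1/p]: [p^i] times the density [q^max(i,n)] of the integers divisible by both [p^i] and
    [p^n]. *)
Definition capped_pow (n i : nat) : R := if (i < n)%N then (/ q) ^ i * q ^ n else 1.

Lemma pow_inv_cancel n : (/ q) ^ n * q ^ n = 1.
Proof. by rewrite -Rpow_mult_distr Rinv_l ?pow1 //; lra. Qed.

(** Passing from [e] to [e + 1] adds one point value, a multiple of the difference of two
    consecutive steps, and its mass is [1 - q]. *)
Lemma trunc_pow_repr e : step_repr1 q (trunc_pow e) (INR e.+1 * (1 - q)).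
Proof.
elim: e => [|e IH].
  apply: step_repr1_ext (step_repr1_plus (step_repr1_step 0)
    (step_repr1_scal (-1) (step_repr1_step 1))).
    by case=> [|i]; rewrite /trunc_pow /=; lra.
  by rewrite /=; lra.
apply: step_repr1_ext (step_repr1_plus IH (step_repr1_scal ((/ q) ^ e.+1)
  (step_repr1_plus (step_repr1_step e.+1) (step_repr1_scal (-1) (step_repr1_step e.+2))))).
  move=> i; rewrite /trunc_pow; case: (ltngtP i e.+1) => ie.
  - have -> : (i <= e)%N by lia.
    by rewrite /=; lra.
  - have -> : (i <= e)%N = false by lia.
    by rewrite /=; lra.
  - rewrite ie ltnn /=; lra.
have := pow_inv_cancel e.+1; rewrite !S_INR.
rewrite [q ^ e.+2]/= -[q * q ^ e]/(q ^ e.+1) => H.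
rewrite Rmult_plus_distr_l H.
have -> : (/ q) ^ e.+1 * (-1 * (q * q ^ e.+1)) = - q * ((/ q) ^ e.+1 * q ^ e.+1) by lra.
by rewrite H; lra.
Qed.

Lemma capped_pow_repr n :
  step_repr1 q (capped_pow n.+1) (q ^ n.+1 * (INR n.+1 * (1 - q) + 1)).
Proof.
apply: step_repr1_ext (step_repr1_plus (step_repr1_scal (q ^ n.+1) (trunc_pow_repr n))
  (step_repr1_step n.+1)); last by lra.
move=> i; rewrite /trunc_pow /capped_pow ltnS.
by case: leqP => ? /=; lra.
Qed.

Definition max3 (i j k : nat) := maxn (maxn i j) k.

Definition gap_weight (nu i j k : nat) : R :=
  if (max3 i j k <= nu)%N then (/ q) ^ (i + j + k) * (q ^ (max3 i j k) - q ^ nu) else 0.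

(** The first six terms form the total mass at an odd prime; the mass of the residues of valuation
    at least [nu] is subtracted. By [gap_massS] the result is the sum over [e < nu] of
    [q^e (1 - q) ((e + 1)(1 - q))^3]. *)
Definition gap_mass (nu : nat) : R :=
  1 + 4 * q + q ^ 2 - (3 * INR nu + 4) * q ^ (nu + 1) - 4 * q ^ (nu + 2)
  + (3 * INR nu + 2) * q ^ (nu + 3)
  - q ^ nu * (1 - 3 * q) * (INR nu.+1 * (1 - q)) ^ 3
  - 3 * (q ^ nu.+1 * (INR nu.+1 * (1 - q) + 1)) * (INR nu.+1 * (1 - q)) ^ 2.

Lemma gap_massS nu :
  gap_mass nu.+1 = gap_mass nu + q ^ nu * (1 - q) * (INR nu.+1 * (1 - q)) ^ 3.
Proof. by rewrite /gap_mass !S_INR !pow_add /=; ring. Qed.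

Lemma gap_mass_ge0 nu : q <= 1 -> 0 <= gap_mass nu.
Proof.
move=> q1; elim: nu => [|nu IH]; first by apply: Req_le; rewrite /gap_mass /=; ring.
rewrite gap_massS; apply: Rplus_le_le_0_compat => //.
apply: Rmult_le_pos; first by apply: Rmult_le_pos; [apply: pow_le|]; lra.
by apply: pow_le; apply: Rmult_le_pos; [apply: pos_INR|lra].
Qed.

(* [gap_weight nu] is the contribution of the residues [n] with valuation below [nu],
   split according to the exact valuation. *)
Lemma gap_weight_repr nu : step_repr q (gap_weight nu) (gap_mass nu).
Proof.
elim: nu => [|nu IH].
  exists [::]; split; last by rewrite /mass big_nil /gap_mass /=; ring.
  move=> i j k; rewrite /steps big_nil /gap_weight leqn0.
  by case: eqP => // ->; lra.
apply: step_repr_ext (step_repr_plus IH (step_repr_scal (q ^ nu * (1 - q))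
  (step_repr_mul (trunc_pow_repr nu) (trunc_pow_repr nu) (trunc_pow_repr nu)))).
  move=> i j k; rewrite /gap_weight /trunc_pow.
  case: (leqP (max3 i j k) nu) => H.
    have -> : (max3 i j k <= nu.+1)%N by lia.
    move: (H); rewrite {1}/max3 !geq_max => /andP[/andP[-> ->] ->].
    by rewrite !pow_add /=; ring.
  have -> : (if (i <= nu)%N then (/ q) ^ i else 0) * (if (j <= nu)%N then (/ q) ^ j else 0) *
    (if (k <= nu)%N then (/ q) ^ k else 0) = 0.
    move: H; rewrite ltnNge /max3 !geq_max !negb_and.
    by case: leqP => ?; case: leqP => ?; case: leqP => ? //= _; lra.
  case: leqP => // H2; last by lra.
  have -> : max3 i j k = nu.+1 by lia.
  by lra.
by rewrite gap_massS; ring.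
Qed.

End StepRepr.

(** For [nu], [mu] the valuations of [h] and [2h], this is [p^(i+j+k)] times the density of the [n]
    with [p^i | n], [p^j | n - h], [p^k | n + h]. The density is [p^(-max)] if the conditions are
    pairwise compatible, and 0 otherwise. *)
Definition local_weight (p nu mu i j k : nat) : R :=
  if [&& (minn i j <= nu)%N, (minn i k <= nu)%N & (minn j k <= mu)%N]
  then INR p ^ (i + j + k - max3 i j k) else 0.

Lemma pow_sub_inv (x : R) (m n : nat) : x <> 0 -> (m <= n)%N ->
  x ^ (n - m) = x ^ n * (/ x) ^ m.
Proof.
move=> x0 mn; rewrite -{2}(subnK mn) pow_add Rmult_assoc -Rpow_mult_distr Rinv_r //.
by rewrite pow1 Rmult_1_r.
Qed.

Lemma local_weightE (p nu mu i j k : nat) : (0 < p)%N ->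
  [&& (minn i j <= nu)%N, (minn i k <= nu)%N & (minn j k <= mu)%N] ->
  local_weight p nu mu i j k =
    INR p ^ i * INR p ^ j * INR p ^ k * (/ INR p) ^ (max3 i j k).
Proof.
move=> p0 H; rewrite /local_weight H pow_sub_inv ?pow_add //; last by rewrite /max3; lia.
by apply: not_0_INR; lia.
Qed.

Lemma local_weight0 (p nu mu i j k : nat) :
  ~~ [&& (minn i j <= nu)%N, (minn i k <= nu)%N & (minn j k <= mu)%N] ->
  local_weight p nu mu i j k = 0.
Proof. by rewrite /local_weight => /negbTE ->. Qed.

(** The bracket of [fpp] at an odd prime, with [q = 1/p]; at [nu = 0] it reduces to
    [(1 - q)^2 (1 + 2q)]. *)
Definition odd_mass (q : R) (nu : nat) : R :=
  1 + 4 * q + q ^ 2 - (3 * INR nu + 4) * q ^ (nu + 1) - 4 * q ^ (nu + 2)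
  + (3 * INR nu + 2) * q ^ (nu + 3).

(* The residues [n] with valuation at least [nu] are [p^nu m]; either [m] avoids the classes
   [0, u, -u] modulo [p] (where [h = p^nu u]) or it lies in exactly one of them. *)
Lemma odd_local_weight_repr (p nu : nat) : (0 < p)%N ->
  step_repr (/ INR p) (local_weight p nu nu) (odd_mass (/ INR p) nu).
Proof.
move=> p0; have P0 : 0 < INR p by apply: lt_0_INR; lia.
have q0 : 0 < / INR p by apply: Rinv_0_lt_compat.
set q := / INR p in q0 *.
have PQ : q * INR p = 1 by rewrite /q Rinv_l //; lra.
have A := trunc_pow_repr q0 nu; have B := capped_pow_repr q0 nu.
apply: step_repr_ext (step_repr_plus (gap_weight_repr q0 nu) (step_repr_plus
  (step_repr_scal (q ^ nu * (1 - 3 * q)) (step_repr_mul A A A))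
  (step_repr_plus (step_repr_mul B A A)
     (step_repr_plus (step_repr_mul A B A) (step_repr_mul A A B))))); last first.
  by rewrite /gap_mass /odd_mass; ring.
move=> i j k; rewrite /gap_weight /trunc_pow /capped_pow !ltnS Rinv_inv.
have E (n : nat) : INR p ^ n * q ^ n = 1.
  by rewrite -Rpow_mult_distr Rmult_comm Rmult_comm Rmult_comm PQ pow1.
(* Two exponents above [nu] are incompatible. A single one is the maximum, so its power of [p]
   cancels and only the term where it is capped survives. *)
case: (leqP i nu) => Hi; case: (leqP j nu) => Hj; case: (leqP k nu) => Hk;
  (have [cpt|cpt] := boolP [&& (minn i j <= nu)%N, (minn i k <= nu)%N & (minn j k <= nu)%N];
   [rewrite local_weightE // -/q | rewrite local_weight0 //]); try lia; try lra.
- have -> : (max3 i j k <= nu)%N by rewrite /max3; lia.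
  by rewrite !pow_add /=; ring.
- have -> : (max3 i j k <= nu)%N = false by rewrite /max3; lia.
  have -> : max3 i j k = k by rewrite /max3; lia.
  by rewrite !Rmult_assoc E; ring.
- have -> : (max3 i j k <= nu)%N = false by rewrite /max3; lia.
  have -> : max3 i j k = j by rewrite /max3; lia.
  have -> : INR p ^ i * INR p ^ j * INR p ^ k * q ^ j
          = INR p ^ i * INR p ^ k * (INR p ^ j * q ^ j) by ring.
  by rewrite E; ring.
- have -> : (max3 i j k <= nu)%N = false by rewrite /max3; lia.
  by lra.
- have -> : (max3 i j k <= nu)%N = false by rewrite /max3; lia.
  have -> : max3 i j k = i by rewrite /max3; lia.
  have -> : INR p ^ i * INR p ^ j * INR p ^ k * q ^ i
          = INR p ^ j * INR p ^ k * (INR p ^ i * q ^ i) by ring.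
  by rewrite E; ring.
all: have -> : (max3 i j k <= nu)%N = false by rewrite /max3; lia.
all: by lra.
Qed.

Lemma even_local_weight_repr (nu : nat) :
  step_repr (/ 2) (local_weight 2 nu nu.+1)
    (52 / 16 - (41 + 15 * INR nu) / 16 * (/ 2) ^ nu).
Proof.
have q0 : 0 < / 2 by lra.
have A := trunc_pow_repr q0 nu; have B := capped_pow_repr q0 nu.
have A' := trunc_pow_repr q0 nu.+1; have B' := capped_pow_repr q0 nu.+1.
(* Writing [n = 2^nu m] and [h = 2^nu u] with [u] odd: [m] is even, or congruent to [u],
   or congruent to [-u] modulo [4]. *)
apply: step_repr_ext (step_repr_plus (gap_weight_repr q0 nu)
  (step_repr_plus (step_repr_mul B A A)
     (step_repr_plus (step_repr_mul A B' A') (step_repr_mul A A' B')))); last first.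
  by rewrite /gap_mass !S_INR !pow_add /=; field.
move=> i j k; rewrite /gap_weight /trunc_pow /capped_pow !ltnS Rinv_inv.
have E (n : nat) : 2 ^ n * (/ 2) ^ n = 1.
  by rewrite -Rpow_mult_distr Rinv_r ?pow1 //; lra.
have [cpt|cpt] := boolP [&& (minn i j <= nu)%N, (minn i k <= nu)%N & (minn j k <= nu.+1)%N];
  last first.
  rewrite local_weight0 //.
  have -> : (max3 i j k <= nu)%N = false by rewrite /max3; lia.
  by case: (leqP i nu) => Hi; case: (leqP j nu) => Hj; case: (leqP k nu) => Hk;
    case: (leqP j nu.+1) => Hj'; case: (leqP k nu.+1) => Hk'; try lia; lra.
rewrite local_weightE // (_ : INR 2 = 2); last by rewrite /=; lra.
case: (leqP i nu) => Hi; last first.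
  have -> : (j <= nu)%N by lia.
  have -> : (k <= nu)%N by lia.
  have -> : (max3 i j k <= nu)%N = false by rewrite /max3; lia.
  have -> : max3 i j k = i by rewrite /max3; lia.
  have -> : 2 ^ i * 2 ^ j * 2 ^ k * (/ 2) ^ i = 2 ^ j * 2 ^ k * (2 ^ i * (/ 2) ^ i) by ring.
  by rewrite E; ring.
case: (leqP j nu.+1) => Hj; last first.
  have -> : (j <= nu)%N = false by lia.
  have -> : (k <= nu.+1)%N by lia.
  have -> : (max3 i j k <= nu)%N = false by rewrite /max3; lia.
  have -> : max3 i j k = j by rewrite /max3; lia.
  have -> : 2 ^ i * 2 ^ j * 2 ^ k * (/ 2) ^ j = 2 ^ i * 2 ^ k * (2 ^ j * (/ 2) ^ j) by ring.
  by rewrite E; ring.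
case: (leqP k nu.+1) => Hk; last first.
  have -> : (k <= nu)%N = false by lia.
  have -> : (max3 i j k <= nu)%N = false by rewrite /max3; lia.
  have -> : max3 i j k = k by rewrite /max3; lia.
  by rewrite !Rmult_assoc E; ring.
have [small|big] := boolP ((j <= nu)%N && (k <= nu)%N).
  case/andP: small => Hj' Hk'; rewrite Hj' Hk'.
  have -> : (max3 i j k <= nu)%N by rewrite /max3; lia.
  by rewrite !pow_add /=; field.
(* Here [j] or [k] equals [nu + 1]: the class of even [m] contributes nothing, and the two classes
   modulo 4 contribute equally. *)
have -> : (max3 i j k <= nu)%N = false by rewrite /max3; lia.
have -> : max3 i j k = nu.+1 by rewrite /max3; lia.
have -> : (2 ^ i * (/ 2) ^ nu.+1) * (if (j <= nu)%N then 2 ^ j else 0) *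
  (if (k <= nu)%N then 2 ^ k else 0) = 0.
  by move: big; case: leqP => ?; case: leqP => ? //= _; lra.
by rewrite /=; field.
Qed.

(* At primes not dividing [2h] the weight is supported on triples with at most one positive
   exponent, so that inclusion-exclusion uses five steps only. *)
Definition coprime_steps : seq (nat * nat * nat * R) :=
  [:: ((0, 0, 0)%N, 1); ((1, 1, 0)%N, -1); ((1, 0, 1)%N, -1); ((0, 1, 1)%N, -1);
      ((1, 1, 1)%N, 2)].

Lemma coprime_stepsE (p i j k : nat) :
  local_weight p 0 0 i j k = steps coprime_steps i j k.
Proof.
rewrite /steps /coprime_steps !big_cons big_nil /local_weight /max3 /=.
case: i => [|i]; case: j => [|j]; case: k => [|k];
  rewrite ?minn0 ?min0n ?minnSS ?maxn0 ?max0n ?addn0 ?add0n ?subnn /=; lra.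
Qed.

Lemma mass_coprime_steps (q : R) : mass q coprime_steps = (1 - q) ^ 2 * (1 + 2 * q).
Proof. by rewrite /mass /coprime_steps !big_cons big_nil /=; ring. Qed.

(** * The weighted sum over triples of divisors *)

(** The pairs [(n, n - h)] and [(n, n + h)] differ by [h], but [n - h] and [n + h] differ by [2h];
    this matters only at [p = 2]. *)
Definition prime_weight (h p : nat) : nat -> nat -> nat -> R :=
  local_weight p (logn p h) (logn p (2 * h)).

(** The constant 11/8 of [c_h] is booked at [p = 2], where it turns the Euler factor 1/2 into
    11/16. *)
Definition prime_mass (h p : nat) : R :=
  fpp p (logn p h) * ((1 - 1 / INR p) ^ 2 * (1 + 2 / INR p)) *
  (if p == 2%N then 11 / 8 else 1).

Lemma prime_INR_ge2 p : prime p -> 2 <= INR p.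
Proof. by move=> /prime_gt1 H; rewrite (_ : 2 = INR 2) //; apply: le_INR; lia. Qed.

Lemma odd_prime_INR_ge3 p : prime p -> p != 2%N -> 3 <= INR p.
Proof.
move=> /prime_gt1 H /eqP p2; rewrite (_ : 3 = INR 3); last by rewrite /=; lra.
by apply: le_INR; lia.
Qed.

Lemma prime_mass_odd h p : prime p -> p != 2%N ->
  prime_mass h p = odd_mass (/ INR p) (logn p h).
Proof.
move=> pp p2; have P2 := odd_prime_INR_ge3 pp p2.
rewrite /prime_mass /fpp (negbTE p2) /odd_mass.
case: eqP => [->|_]; first by rewrite /=; field; lra.
rewrite !pow_add !pow_inv; field.
by repeat split; try apply: pow_nonzero; lra.
Qed.

Lemma prime_mass_two h :
  prime_mass h 2 = 52 / 16 - (41 + 15 * INR (logn 2 h)) / 16 * (/ 2) ^ logn 2 h.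
Proof.
rewrite /prime_mass /fpp eqxx (_ : INR 2 = 2); last by rewrite /=; lra.
case: eqP => [->|_]; first by rewrite /=; field.
by rewrite pow_inv; field; apply: pow_nonzero; lra.
Qed.

Lemma prime_weight_repr h p : (0 < h)%N -> prime p ->
  step_repr (/ INR p) (prime_weight h p) (prime_mass h p).
Proof.
move=> h0 pp; rewrite /prime_weight; have [p2|p2] := eqVneq p 2%N.
  rewrite p2 prime_mass_two lognM // (_ : logn 2 2 = 1%N) // add1n.
  rewrite (_ : INR 2 = 2); last by rewrite /=; lra.
  exact: even_local_weight_repr.
rewrite prime_mass_odd // lognM // (_ : logn p 2 = 0%N).
  by apply: odd_local_weight_repr; apply: prime_gt0.
by rewrite logn_prime //; move/eqP: p2; case: eqP => // <-.
Qed.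

(** Adding back to [gap_mass] the residues of valuation at least [nu] gives nonnegative terms;
    [1 - 3q >= 0] is the share of the classes other than [0], [u], [-u]. *)
Lemma odd_mass_ge0 q nu : 0 < q -> q <= 1 / 3 -> 0 <= odd_mass q nu.
Proof.
move=> q0 q3; have := @gap_mass_ge0 q q0 nu ltac:(lra); rewrite /gap_mass -/(odd_mass q nu).
set x := INR nu.+1 * (1 - q); have x0 : 0 <= x.
  by apply: Rmult_le_pos; [apply: pos_INR | lra].
move: x x0 => x x0.
have : 0 <= q ^ nu * (1 - 3 * q) * x ^ 3.
  by repeat apply: Rmult_le_pos; try apply: pow_le; lra.
have : 0 <= 3 * (q ^ nu.+1 * (x + 1)) * x ^ 2.
  by repeat apply: Rmult_le_pos; try apply: pow_le; lra.
lra.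
Qed.

Lemma fpp_ge0 p nu : prime p -> 0 <= fpp p nu.
Proof.
(* Every [nu] is the valuation of [p^nu], so at odd [p] the sign can be read off from
   [prime_mass_odd] with [h = p^nu]. *)
move=> pp; have := pfactorK nu pp.
have [p2 _|p2 <-] := eqVneq p 2%N.
  rewrite /fpp p2 eqxx; case: eqP => [_|_]; first by lra.
  have pow_nu : 1 + INR nu <= 2 ^ nu.
    elim: nu => [|nu IH]; first by rewrite /=; lra.
    by rewrite S_INR /=; have := pos_INR nu; lra.
  have nu0 := pos_INR nu.
  have -> : 52 / 11 - (41 + 15 * INR nu) / (11 * 2 ^ nu)
          = (52 * 2 ^ nu - (41 + 15 * INR nu)) / (11 * 2 ^ nu) by field; lra.
  by apply: Rdiv_le_0_compat; lra.
have P3 := odd_prime_INR_ge3 pp p2; have q0 : 0 < / INR p by apply: Rinv_0_lt_compat; lra.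
have q3 : / INR p <= 1 / 3 by rewrite /Rdiv Rmult_1_l; apply: Rinv_le_contravar; lra.
have := odd_mass_ge0 (logn p (p ^ nu)) q0 q3.
rewrite -prime_mass_odd // /prime_mass (negbTE p2) Rmult_1_r /Rdiv Rmult_1_l => H.
apply: (Rmult_le_reg_r ((1 - / INR p) ^ 2 * (1 + 2 * / INR p))); last by lra.
by apply: Rmult_lt_0_compat; first apply: pow_lt; lra.
Qed.

(** Conditions at primes from [N] on are ignored: [N = 0] gives [1/(abc)], while [N > abc] gives the
    true density, [1/lcm(a,b,c)] or 0. *)
Definition triple_weight (h N a b c : nat) : R :=
  (\big[Rmult/1]_(0 <= p < N | prime p) prime_weight h p (logn p a) (logn p b) (logn p c)) *
  (/ INR a * / INR b * / INR c).

Definition triple_sum (h N s t r : nat) : R := sum3 s t r (triple_weight h N).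

Definition triple_mass (h N : nat) : R := \big[Rmult/1]_(0 <= p < N | prime p) prime_mass h p.

Lemma triple_sum_nonprime h N s t r : ~~ prime N ->
  triple_sum h N.+1 s t r = triple_sum h N s t r.
Proof.
move=> pN; apply: eq_sum3 => a b c _ _ _; rewrite /triple_weight.
by rewrite big_mkcond big_nat_recr //= (negbTE pN) -big_mkcond Rmult_1_r.
Qed.

Lemma triple_weight_prime h N a b c : prime N ->
  triple_weight h N.+1 a b c =
  prime_weight h N (logn N a) (logn N b) (logn N c) * triple_weight h N a b c.
Proof.
move=> pN; rewrite /triple_weight big_mkcond big_nat_recr //= pN -big_mkcond /=; ring.
Qed.

Lemma triple_mass_nonprime h N : ~~ prime N -> triple_mass h N.+1 = triple_mass h N.
Proof.
by move=> pN; rewrite /triple_mass big_mkcond big_nat_recr //= (negbTE pN) -big_mkcond Rmult_1_r.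
Qed.

Lemma triple_mass_prime h N : prime N -> triple_mass h N.+1 = prime_mass h N * triple_mass h N.
Proof.
by move=> pN; rewrite /triple_mass big_mkcond big_nat_recr //= pN -big_mkcond Rmult_comm.
Qed.

Lemma logn_pfactor_mul p q i a : prime p -> prime q -> q != p -> (0 < a)%N ->
  logn q (p ^ i * a) = logn q a.
Proof.
move=> pp pq qp a0; rewrite lognM ?expn_gt0 ?(prime_gt0 pp) // lognX logn_prime // (negbTE qp).
by rewrite muln0.
Qed.

Lemma triple_weight_scale h N i j k a b c :
  prime N -> (0 < a)%N -> (0 < b)%N -> (0 < c)%N ->
  triple_weight h N (N ^ i * a) (N ^ j * b) (N ^ k * c) =
  (/ INR N) ^ (i + j + k) * triple_weight h N a b c.
Proof.
move=> pN a0 b0 c0; rewrite /triple_weight.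
have -> : \big[Rmult/1]_(0 <= p < N | prime p) prime_weight h p
      (logn p (N ^ i * a)) (logn p (N ^ j * b)) (logn p (N ^ k * c))
  = \big[Rmult/1]_(0 <= p < N | prime p) prime_weight h p (logn p a) (logn p b) (logn p c).
  rewrite big_nat_cond [RHS]big_nat_cond; apply: eq_bigr => p /andP[/andP[_ ltpN] pp].
  have pnN : p != N by rewrite neq_ltn ltpN.
  by rewrite (logn_pfactor_mul i pN pp pnN a0) (logn_pfactor_mul j pN pp pnN b0)
    (logn_pfactor_mul k pN pp pnN c0).
have N0 := prime_INR_ge2 pN.
have nz n : (0 < n)%N -> INR n <> 0 by move=> n0; apply: not_0_INR; lia.
rewrite !mult_INR !INR_expn !pow_add !pow_inv; field.
have N0' : INR N <> 0 by lra.
by repeat split; first [exact: nz | exact: N0' | apply: pow_nonzero; exact: N0'].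
Qed.

(** Each step at [N] is a divisibility by powers of [N]. Substituting multiples dilates the ranges,
    and the conditions at smaller primes do not see the powers of [N]. *)
Lemma triple_sum_step h N T s t r : prime N ->
  (forall i j k, prime_weight h N i j k = steps T i j k) ->
  triple_sum h N.+1 s t r =
  \rsum_(u <- T) (u.2 * (/ INR N) ^ (u.1.1.1 + u.1.1.2 + u.1.2) *
    triple_sum h N (s %/ N ^ u.1.1.1) (t %/ N ^ u.1.1.2) (r %/ N ^ u.1.2)).
Proof.
move=> pN HT; have N0 i : (0 < N ^ i)%N by rewrite expn_gt0 prime_gt0.
transitivity (sum3 s t r (fun a b c => \rsum_(u <- T) (u.2 *
    (ind (N ^ u.1.1.1 %| a) * ind (N ^ u.1.1.2 %| b) * ind (N ^ u.1.2 %| c) *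
     triple_weight h N a b c)))).
  apply: eq_sum3 => a b c /andP[a0 _] /andP[b0 _] /andP[c0 _].
  rewrite triple_weight_prime // HT /steps big_distrl; apply: eq_bigr => u _ /=.
  by rewrite !pfactor_dvdn //; ring.
rewrite sum3_rsum; apply: eq_bigr => u _; rewrite sum3_scal sum3_dvdn // Rmult_assoc.
congr (_ * _); rewrite /triple_sum -sum3_scal; apply: eq_sum3 => a b c.
by move=> /andP[a0 _] /andP[b0 _] /andP[c0 _]; apply: triple_weight_scale.
Qed.

(** * Asymptotics by induction on the primes *)

(** The power [a^(1/4)]: multiplicative, larger than a multiple of the logarithm, and small enough
    that the error factors [1 + O(p^(-2) p^(2/4))] have a convergent product. *)
Definition tau (a : nat) : R := sqrt (sqrt (INR a)).

(** The factor by which the error constant grows when the prime [p] is inserted: a dilation by [p^i]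
    costs [tau p ^ i]. *)
Definition step_norm (p : nat) (T : seq (nat * nat * nat * R)) : R :=
  \rsum_(u <- T) (Rabs u.2 * (/ INR p) ^ (u.1.1.1 + u.1.1.2 + u.1.2) *
    tau p ^ (u.1.1.1 + u.1.1.2 + u.1.2)).

Lemma tau_ge0 a : 0 <= tau a. Proof. exact: sqrt_pos. Qed.

Lemma tauM a b : tau (a * b) = tau a * tau b.
Proof. by rewrite /tau mult_INR sqrt_mult ?sqrt_mult //; try apply: sqrt_pos; apply: pos_INR. Qed.

Lemma tauX a i : tau (a ^ i) = tau a ^ i.
Proof. by elim: i => [|i IH]; rewrite ?expnS ?tauM ?IH // /tau /= !sqrt_1. Qed.

Lemma step_norm_ge0 p T : (0 < p)%N -> 0 <= step_norm p T.
Proof.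
move=> p0; apply: big_ind => //; first by lra.
  by move=> x y; lra.
move=> u _; repeat apply: Rmult_le_pos; first exact: Rabs_pos.
  by apply: pow_le; left; apply: Rinv_0_lt_compat; apply: lt_0_INR; lia.
by apply: pow_le; apply: tau_ge0.
Qed.

(** The dilations [a], [b], [c] are quantified so that the induction closes: inserting a prime
    multiplies them by its powers. Quotients may vanish; the factors [tau] absorb this. *)
Definition triple_approx (h N : nat) (E : R) : Prop :=
  0 <= E /\ forall y a b c, (0 < y)%N -> (0 < a)%N -> (0 < b)%N -> (0 < c)%N ->
  Rabs (triple_sum h N (y %/ a) (y %/ b) (y %/ c) - triple_mass h N * ln (INR y) ^ 3)
    <= E * (tau a * tau b * tau c) * (1 + ln (INR y)) ^ 2.

Lemma triple_approx_nonprime h N E : ~~ prime N ->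
  triple_approx h N E -> triple_approx h N.+1 E.
Proof.
move=> pN [E0 HE]; split=> // y a b c; rewrite triple_sum_nonprime // triple_mass_nonprime //.
exact: HE.
Qed.

Lemma triple_approx_prime h N E T : prime N ->
  (forall i j k, prime_weight h N i j k = steps T i j k) ->
  mass (/ INR N) T = prime_mass h N ->
  triple_approx h N E -> triple_approx h N.+1 (step_norm N T * E).
Proof.
move=> pN HT mT [E0 HE]; split.
  by apply: Rmult_le_pos => //; apply: step_norm_ge0; apply: prime_gt0.
move=> y a b c y0 a0 b0 c0.
rewrite (triple_sum_step _ _ _ pN HT) triple_mass_prime // -mT /mass.
rewrite Rmult_assoc big_distrl.
have -> : step_norm N T * E * (tau a * tau b * tau c) * (1 + ln (INR y)) ^ 2 =
  step_norm N T * (E * (tau a * tau b * tau c) * (1 + ln (INR y)) ^ 2) by ring.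
rewrite /step_norm big_distrl; apply: rsum_abs_sub_le => u /=.
(* Iterated floors merge, so each dilated sum is again an instance of the induction hypothesis. *)
rewrite -!divnMA. rewrite -Rmult_minus_distr_l !Rabs_mult.
rewrite [Rabs (_ ^ _)]Rabs_pos_eq; last first.
  apply: pow_le; left; apply: Rinv_0_lt_compat; have := prime_INR_ge2 pN; lra.
rewrite [X in _ <= X]Rmult_assoc.
apply: Rmult_le_compat_l.
  apply: Rmult_le_pos; first exact: Rabs_pos.
  apply: pow_le; left; apply: Rinv_0_lt_compat; have := prime_INR_ge2 pN; lra.
have gt0 x i : (0 < x)%N -> (0 < x * N ^ i)%N.
  by move=> x0; rewrite muln_gt0 x0 expn_gt0 prime_gt0.
apply: Rle_trans (HE y (a * N ^ u.1.1.1) (b * N ^ u.1.1.2) (c * N ^ u.1.2) _ _ _ _)%N _;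
  rewrite ?gt0 //.
by apply: Req_le; rewrite !tauM !tauX !pow_add; ring.
Qed.

(** * Harmonic sums and the base case *)

Definition hsum (s : nat) : R := \rsum_(1 <= a < s.+1) / INR a.

Lemma hsumS s : hsum s.+1 = hsum s + / INR s.+1.
Proof. by rewrite /hsum big_nat_recr. Qed.

Lemma exp_le x y : x <= y -> exp x <= exp y.
Proof. by case=> [/exp_increasing|->]; lra. Qed.

Lemma ln_le_sub1 x : 0 < x -> ln x <= x - 1.
Proof.
move=> x0; have := exp_ineq1_le (ln x); rewrite exp_ln //; lra.
Qed.

Lemma ln_INR_ge0 n : (0 < n)%N -> 0 <= ln (INR n).
Proof.
by move=> n0; rewrite -ln_1; apply: ln_le; [lra|rewrite -INR_1; apply: le_INR; lia].
Qed.

Lemma hsum_ge_ln s : ln (INR s.+1) <= hsum s.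
Proof.
elim: s => [|s IH]; first by rewrite /hsum big_nil ln_1; lra.
rewrite hsumS.
have s0 : 0 < INR s.+1 by apply: lt_0_INR; lia.
have s1 : 0 < INR s.+2 by apply: lt_0_INR; lia.
have := @ln_le_sub1 (INR s.+2 / INR s.+1) (Rdiv_lt_0_compat _ _ s1 s0).
rewrite ln_div //.
have -> : INR s.+2 / INR s.+1 - 1 = / INR s.+1 by rewrite [INR s.+2]S_INR; field; lra.
by lra.
Qed.

Lemma hsum_le_ln s : (0 < s)%N -> hsum s <= 1 + ln (INR s).
Proof.
case: s => // s _; elim: s => [|s IH].
  by rewrite /hsum big_nat1 /= ln_1; lra.
rewrite hsumS.
have s0 : 0 < INR s.+1 by apply: lt_0_INR; lia.
have s1 : 0 < INR s.+2 by apply: lt_0_INR; lia.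
have := @ln_le_sub1 (INR s.+1 / INR s.+2) (Rdiv_lt_0_compat _ _ s0 s1).
rewrite ln_div //.
have -> : INR s.+1 / INR s.+2 - 1 = - / INR s.+2.
  by move: s1; rewrite [INR s.+2]S_INR => ?; field; lra.
by lra.
Qed.

Lemma hsum_ge0 s : 0 <= hsum s.
Proof. by have := hsum_ge_ln s; have := @ln_INR_ge0 s.+1 isT; lra. Qed.

Lemma hsum_divn_le y a : (0 < y)%N -> (0 < a)%N -> hsum (y %/ a) <= 1 + ln (INR y).
Proof.
move=> y0 a0; have ly := ln_INR_ge0 y0.
have [->|] := eqVneq (y %/ a)%N 0%N; first by rewrite /hsum big_nil; lra.
rewrite -lt0n => q0; apply: Rle_trans (hsum_le_ln q0) _.
apply: Rplus_le_compat_l; apply: ln_le; first by apply: lt_0_INR; lia.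
by apply: le_INR; have := leq_div y a; lia.
Qed.

(** [ln a = 4 ln (tau a)] and [ln t <= t - 1]. *)
Lemma ln_le_tau a : (0 < a)%N -> 1 + ln (INR a) <= 4 * tau a.
Proof.
move=> a0; have A0 : 0 < INR a by apply: lt_0_INR; lia.
have S0 := sqrt_lt_R0 _ A0; have T0 := sqrt_lt_R0 _ S0.
have E : INR a = tau a ^ 4.
  rewrite /tau -[in LHS](sqrt_sqrt (INR a)); last lra.
  by rewrite -{1 2}(sqrt_sqrt (sqrt (INR a))); [ring|lra].
have := @ln_le_sub1 (tau a) T0; rewrite E ln_pow //= => H; lra.
Qed.

Lemma tau_ge1 a : (0 < a)%N -> 1 <= tau a.
Proof.
move=> a0; have H : 1 <= INR a by rewrite -INR_1; apply: le_INR; lia.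
have {}H : 1 <= sqrt (INR a) by rewrite -sqrt_1; apply: sqrt_le_1_alt.
by rewrite /tau -sqrt_1; apply: sqrt_le_1_alt.
Qed.

(** The sum lies between [ln y - ln a] and [1 + ln y], even when [a > y], so the deviation is at
    most [1 + ln a]. *)
Lemma hsum_divn_approx y a : (0 < y)%N -> (0 < a)%N ->
  Rabs (hsum (y %/ a) - ln (INR y)) <= 4 * tau a.
Proof.
move=> y0 a0; apply: Rle_trans (ln_le_tau a0).
have la := ln_INR_ge0 a0; have up := hsum_divn_le y0 a0.
have lo : ln (INR y) - ln (INR a) <= hsum (y %/ a).
  apply: Rle_trans (hsum_ge_ln _).
  have A0 : 0 < INR a by apply: lt_0_INR; lia.
  have Y0 : 0 < INR y by apply: lt_0_INR; lia.
  rewrite -ln_div //; apply: ln_le; first exact: Rdiv_lt_0_compat.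
  apply: (Rmult_le_reg_r (INR a)) => //; rewrite /Rdiv Rmult_assoc Rinv_l ?Rmult_1_r; last lra.
  by rewrite -mult_INR; apply: le_INR; have := ltn_ceil y a0; lia.
by split_Rabs; lra.
Qed.

(** Replacing the factors by [l] one at a time gives three differences, each at most
    [4ABC (1 + l)^2]; hence the 12. *)
Lemma mul3_approx (x y z l A B C : R) :
  0 <= l -> 1 <= A -> 1 <= B -> 1 <= C -> 0 <= y <= 1 + l -> 0 <= z <= 1 + l ->
  Rabs (x - l) <= 4 * A -> Rabs (y - l) <= 4 * B -> Rabs (z - l) <= 4 * C ->
  Rabs (x * y * z - l ^ 3) <= 12 * (A * B * C) * (1 + l) ^ 2.
Proof.
move=> l0 A1 B1 C1 [y0 y1] [z0 z1] Hx Hy Hz.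
have -> : x * y * z - l ^ 3 = (x - l) * (y * z) + ((y - l) * (l * z) + (z - l) * (l * l)) by ring.
have AB : 1 <= A * B by nra.
have AC : 1 <= A * C by nra.
have BC : 1 <= B * C by nra.
have A2 : 0 <= A * (B * C - 1) by apply: Rmult_le_pos; lra.
have B2 : 0 <= B * (A * C - 1) by apply: Rmult_le_pos; lra.
have C2 : 0 <= C * (A * B - 1) by apply: Rmult_le_pos; lra.
have b1 : 0 <= y * z <= (1 + l) ^ 2 by nra.
have b2 : 0 <= l * z <= (1 + l) ^ 2 by nra.
have b3 : 0 <= l * l <= (1 + l) ^ 2 by nra.
have L u v w W : Rabs u <= 4 * v -> 1 <= v -> v <= W -> 0 <= w <= (1 + l) ^ 2 ->
    Rabs (u * w) <= 4 * W * (1 + l) ^ 2.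
  move=> Hu v1 vW [w0 w1]; rewrite Rabs_mult (Rabs_pos_eq w) //.
  by apply: Rmult_le_compat => //; [apply: Rabs_pos|lra].
have L1 : Rabs ((x - l) * (y * z)) <= 4 * (A * B * C) * (1 + l) ^ 2 by apply: (L _ _ _ _ Hx) => //; lra.
have L2 : Rabs ((y - l) * (l * z)) <= 4 * (A * B * C) * (1 + l) ^ 2 by apply: (L _ _ _ _ Hy) => //; lra.
have L3 : Rabs ((z - l) * (l * l)) <= 4 * (A * B * C) * (1 + l) ^ 2 by apply: (L _ _ _ _ Hz) => //; lra.
apply: Rle_trans (Rabs_triang _ _) _; have := Rabs_triang ((y - l) * (l * z)) ((z - l) * (l * l)).
by lra.
Qed.

Lemma triple_approx0 h : triple_approx h 0 12.
Proof.
split=> [|y a b c y0 a0 b0 c0]; first by lra.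
have -> s t r : triple_sum h 0 s t r = hsum s * hsum t * hsum r.
  rewrite /triple_sum /hsum -sum3_mul; apply: eq_sum3 => a' b' c' _ _ _.
  by rewrite /triple_weight big_geq // Rmult_1_l.
rewrite /triple_mass big_geq // Rmult_1_l; apply: mul3_approx.
all: try exact: tau_ge1.
all: try exact: hsum_divn_approx.
- exact: ln_INR_ge0.
- by split; [apply: hsum_ge0|apply: hsum_divn_le].
- by split; [apply: hsum_ge0|apply: hsum_divn_le].
Qed.

(** Here [E] may depend on [N]: this serves only the finitely many primes up to [2h], where the step
    representation is not explicit. *)
Lemma triple_approx_exists h N : (0 < h)%N -> exists E, triple_approx h N E.
Proof.
move=> h0; elim: N => [|N [E HE]]; first by exists 12; apply: triple_approx0.
have [pN|pN] := boolP (prime N); last by exists E; apply: triple_approx_nonprime.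
have [T [HT mT]] := prime_weight_repr h0 pN.
by exists (step_norm N T * E); apply: triple_approx_prime.
Qed.

Lemma triple_approx_weaken h N E E' : E <= E' -> triple_approx h N E -> triple_approx h N E'.
Proof.
move=> EE [E0 H]; split=> [|y a b c y0 a0 b0 c0]; first by lra.
apply: Rle_trans (H _ _ _ _ y0 a0 b0 c0) _.
apply: Rmult_le_compat_r; first by apply: pow_le; have := ln_INR_ge0 y0; lra.
apply: Rmult_le_compat_r => //.
by repeat apply: Rmult_le_pos; apply: tau_ge0.
Qed.

(** * Uniformity in the number of primes *)

(** No step has exactly one positive exponent. Three steps cost [p^(-2) p^(1/2) = p^(-3/2)], and the
    last costs [2 p^(-9/4) <= 2 p^(-3/2)]. *)
Lemma step_norm_coprime p : (1 < p)%N ->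
  step_norm p coprime_steps <= 1 + 5 * / sqrt (INR p) ^ 3.
Proof.
move=> p1; have P1 : 1 < INR p by rewrite -INR_1; apply: lt_INR; lia.
have S1 : 1 < sqrt (INR p) by rewrite -sqrt_1; apply: sqrt_lt_1_alt; lra.
have T1 : 1 < tau p by rewrite /tau -sqrt_1; apply: sqrt_lt_1_alt; lra.
have ES : INR p = sqrt (INR p) ^ 2 by rewrite /= Rmult_1_r sqrt_sqrt //; lra.
have ET : sqrt (INR p) = tau p ^ 2 by rewrite /= Rmult_1_r /tau sqrt_sqrt //; lra.
rewrite /step_norm /coprime_steps !big_cons big_nil /= !Rabs_Ropp !Rabs_R1.
rewrite (Rabs_pos_eq 2); last lra.
have EP : INR p = tau p ^ 4.
  by rewrite ES ET; ring.
rewrite ET EP; set t := tau p in T1 *.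
have t0 : t <> 0 by lra.
have I0 : 0 < / t by apply: Rinv_0_lt_compat; lra.
have I1 : / t <= 1 by rewrite -Rinv_1; apply: Rinv_le_contravar; lra.
set w := / t in I0 I1.
have tw : t * w = 1 by rewrite /w Rinv_r.
have -> : / t ^ 4 = w ^ 4 by rewrite /w; field.
have -> : / (t ^ 2 * (t ^ 2 * (t ^ 2 * 1))) = w ^ 6 by rewrite /w; field.
have E1 : w ^ 8 * t ^ 2 = w ^ 6.
  have -> : w ^ 8 * t ^ 2 = (t * w) ^ 2 * w ^ 6 by ring.
  by rewrite tw; ring.
have E2 : w ^ 12 * t ^ 3 = w ^ 9.
  have -> : w ^ 12 * t ^ 3 = (t * w) ^ 3 * w ^ 9 by ring.
  by rewrite tw; ring.
have L : w ^ 9 <= w ^ 6.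
  rewrite -[X in _ <= X]Rmult_1_r (_ : 9 = 6 + 3)%N // pow_add.
  apply: Rmult_le_compat_l; first by apply: pow_le; lra.
  by rewrite -(pow1 3); apply: pow_incr; lra.
lra.
Qed.

Lemma inv_sqrt3_le_telescope n : (0 < n)%N ->
  / sqrt (INR n.+1) ^ 3 <= 2 * (/ sqrt (INR n) - / sqrt (INR n.+1)).
Proof.
move=> n0; have N0 : 0 < INR n by apply: lt_0_INR; lia.
have a0 := sqrt_lt_R0 _ N0.
have ab : sqrt (INR n) <= sqrt (INR n.+1) by apply: sqrt_le_1_alt; rewrite S_INR; lra.
have ea : sqrt (INR n) * sqrt (INR n) = INR n by apply: sqrt_sqrt; lra.
have eb : sqrt (INR n.+1) * sqrt (INR n.+1) = sqrt (INR n) * sqrt (INR n) + 1.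
  by rewrite ea -S_INR; apply: sqrt_sqrt; apply: pos_INR.
move: (sqrt (INR n)) (sqrt (INR n.+1)) a0 ab eb {ea} => a b a0 ab ebb.
(* As [b^2 - a^2 = 1], the right side is [2/(ab(a + b))], and the claim becomes
   [a(a + b) <= 2b^2]. *)
have -> : 2 * (/ a - / b) = (2 * (b - a) * (a + b)) * (b ^ 2) / (a * b ^ 3 * (a + b)).
  by field; lra.
have -> : 2 * (b - a) * (a + b) = 2 by nra.
have b0 : 0 < b by lra.
have D : 0 < a * b ^ 3 * (a + b).
  by apply: Rmult_lt_0_compat; [apply: Rmult_lt_0_compat => //; apply: pow_lt|lra].
apply: (Rmult_le_reg_r (a * b ^ 3 * (a + b))) => //.
rewrite [X in _ <= X](_ : _ = 2 * b ^ 2); last by field; lra.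
have -> : / b ^ 3 * (a * b ^ 3 * (a + b)) = a * (a + b) by field; lra.
nra.
Qed.

Lemma prime_weight_coprime h p i j k : (0 < h)%N -> (2 * h < p)%N ->
  prime_weight h p i j k = steps coprime_steps i j k.
Proof.
move=> h0 hp; rewrite /prime_weight.
have L0 m : (0 < m < p)%N -> logn p m = 0%N.
  move=> /andP[m0 mp]; rewrite lognE m0 /=.
  by case: (boolP (p %| m)) => [/dvdn_leq|]; rewrite ?andbF //; lia.
by rewrite !L0 ?coprime_stepsE //; lia.
Qed.

Lemma prime_mass_coprime h p : (0 < h)%N -> (2 * h < p)%N -> prime p ->
  prime_mass h p = mass (/ INR p) coprime_steps.
Proof.
move=> h0 hp pp; rewrite mass_coprime_steps /prime_mass.
have -> : (p == 2%N) = false by lia.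
have -> : logn p h = 0%N.
  rewrite lognE; case: (boolP (p %| h)) => [/dvdn_leq|]; rewrite ?andbF //; lia.
by rewrite /fpp eqxx /Rdiv; ring.
Qed.

(** Each new prime costs at most [1 + 5 p^(-3/2) <= exp (5 p^(-3/2))]. The exponents telescope, and
    [10 = 5 * 2]; composite indices only enlarge the bound. *)
Lemma triple_approx_tail h E n : (0 < h)%N -> triple_approx h (2 * h).+1 E ->
  triple_approx h (2 * h + n).+1
    (exp (10 * (/ sqrt (INR (2 * h)) - / sqrt (INR (2 * h + n)))) * E).
Proof.
move=> h0 H0; elim: n => [|n IH]; first by rewrite addn0 Rminus_diag Rmult_0_r exp_0 Rmult_1_l.
have tel := @inv_sqrt3_le_telescope (2 * h + n) ltac:(lia).
rewrite addnS; have [E0 _] := IH; have [E00 _] := H0.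
have [pN|pN] := boolP (prime (2 * h + n).+1); last first.
  apply: triple_approx_weaken (triple_approx_nonprime pN IH).
  apply: Rmult_le_compat_r => //.
  have : 0 < / sqrt (INR (2 * h + n).+1) ^ 3.
    by apply: Rinv_0_lt_compat; apply: pow_lt; apply: sqrt_lt_R0; apply: lt_0_INR; lia.
  by move=> ?; apply: exp_le; lra.
apply: triple_approx_weaken (triple_approx_prime pN _ _ IH) => [|i j k|]; last first.
- by rewrite prime_mass_coprime //; lia.
- by apply: prime_weight_coprime => //; lia.
rewrite -Rmult_assoc; apply: Rmult_le_compat_r => //.
set x := (X in exp X); set y := (X in _ <= exp X).
have -> : y = (y - x) + x by lra.
rewrite exp_plus; apply: Rmult_le_compat_r; first by left; apply: exp_pos.
apply: Rle_trans (step_norm_coprime (prime_gt1 pN)) _.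
apply: Rle_trans (exp_ineq1_le _) _; apply: exp_le; rewrite /x /y; lra.
Qed.

Lemma triple_approx_uniform h : (0 < h)%N ->
  exists E, forall N, (2 * h < N)%N -> triple_approx h N E.
Proof.
move=> h0; have [E HE] := triple_approx_exists (2 * h).+1 h0.
exists (exp 10 * E) => N hN; have [E0 _] := HE.
have -> : N = (2 * h + (N - (2 * h).+1)).+1 by lia.
apply: triple_approx_weaken (triple_approx_tail _ h0 HE).
apply: Rmult_le_compat_r => //; apply: exp_le.
have : / sqrt (INR (2 * h)) <= 1.
  rewrite -Rinv_1 -sqrt_1; apply: Rinv_le_contravar; first by rewrite sqrt_1; lra.
  by apply: sqrt_le_1_alt; rewrite -INR_1; apply: le_INR; lia.
have : 0 <= / sqrt (INR (2 * h + (N - (2 * h).+1))).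
  by left; apply: Rinv_0_lt_compat; apply: sqrt_lt_R0; apply: lt_0_INR; lia.
lra.
Qed.

(** * Counting common solutions of the divisibility conditions *)

Lemma chinese_noncoprime m n u v : (0 < m)%N -> (0 < n)%N -> u = v %[mod gcdn m n] ->
  exists z, z = u %[mod m] /\ z = v %[mod n].
Proof.
move=> m0 n0 uv; have [a _ Ha] := Bezoutr m n0.
(* Adding [m * v] keeps the class modulo [m] and makes [u' - v] a true difference. The Bezout
   coefficient satisfies [a * m = - gcdn m n] modulo [n], so a multiple of [m] can remove
   [u' - v]. *)
pose u' := (u + m * v)%N.
have vu' : (v <= u')%N by rewrite /u'; nia.
have gu' : gcdn m n %| u' - v.
  rewrite -eqn_mod_dvd // /u' -uv; apply/eqP.
  by rewrite -modnDmr; have /eqP -> := dvdn_mulr v (dvdn_gcdl m n); rewrite addn0.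
exists (u' + m * (a * ((u' - v) %/ gcdn m n)))%N; split.
  by rewrite /u' -addnA -mulnDr addnC mulnC modnMDl.
apply/eqP; rewrite eqn_mod_dvd; last by apply: leq_trans vu' (leq_addr _ _).
have -> : (u' + m * (a * ((u' - v) %/ gcdn m n)) - v =
           ((u' - v) %/ gcdn m n) * (gcdn m n + a * m))%N.
  by rewrite -addnBAC // -{1}(divnK gu') mulnDr; congr (_ + _)%N; rewrite mulnC -mulnA mulnCA.
exact: dvdn_mull.
Qed.


(** On valuations this is distributivity of the minimum over the maximum. *)
Lemma gcdn_lcml a b c : (0 < a)%N -> (0 < b)%N -> (0 < c)%N ->
  gcdn (lcmn a b) c = lcmn (gcdn a c) (gcdn b c).
Proof.
move=> a0 b0 c0; apply: eqn_from_log; rewrite ?lcmn_gt0 ?gcdn_gt0 ?c0 ?orbT //.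
move=> p; rewrite logn_gcd ?lcmn_gt0 ?a0 ?b0 // logn_lcm // logn_lcm ?gcdn_gt0 ?c0 ?orbT //.
by rewrite !logn_gcd //; lia.
Qed.

Lemma sum_eqmod_ge m r X : (0 < m)%N ->
  (X %/ m <= \sum_(0 <= n < X) (n == r %[mod m]))%N.
Proof.
move=> m0; have H q : (q <= \sum_(0 <= n < q * m) (n == r %[mod m]))%N.
  elim: q => [//|q IH].
  rewrite (@big_cat_nat _ _ _ (q * m)) //=; last by nia.
  have mem : (q * m + r %% m)%N \in index_iota (q * m) (q.+1 * m).
    by rewrite mem_index_iota; have := ltn_pmod r m0; lia.
  rewrite [X in (_ + X)%N](bigD1_seq _ mem (iota_uniq _ _)) /=.
  by rewrite modnMDl modn_mod eqxx; lia.
apply: leq_trans (H (X %/ m)%N) _.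
by rewrite [X in (_ <= X)%N](@big_cat_nat _ _ _ (X %/ m * m)) ?leq_addr // leq_divM.
Qed.

Definition divisor_triple (h a b c n : nat) : bool := [&& a %| n, b %| n - h & c %| n + h].

Definition triple_count (h X a b c : nat) : nat :=
  \sum_(h.+1 <= n < X.+1) divisor_triple h a b c n.

Definition lcm3 (a b c : nat) : nat := lcmn (lcmn a b) c.

Lemma sum_divides_le_dnum y m : (0 < m)%N -> (\sum_(1 <= a < y.+1) (a %| m) <= dnum m)%N.
Proof.
move=> m0; rewrite -[leqLHS](_ : \sum_(1 <= a < y.+1 | a %| m) 1 = _)%N; last first.
  by rewrite big_mkcond; apply: eq_bigr => a _; case: (_ %| _).
rewrite sum1_count -size_filter; apply: uniq_leq_size.
  by apply: filter_uniq; apply: iota_uniq.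
by move=> a; rewrite mem_filter -dvdn_divisors // => /andP[].
Qed.

(** After exchanging the sums, only the divisors up to [y] are counted, and the terms with [n <= h]
    are dropped, so that [n - h] is positive. *)
Lemma triple_count_le_Ssum h y x :
  (\sum_(1 <= a < y.+1) \sum_(1 <= b < y.+1) \sum_(1 <= c < y.+1)
     triple_count h (Z.to_nat (Int_part x)) a b c <= Ssum h x)%N.
Proof.
rewrite /Ssum; set X := Z.to_nat _.
pose dy m := (\sum_(1 <= a < y.+1) (a %| m))%N.
have -> : (\sum_(1 <= a < y.+1) \sum_(1 <= b < y.+1) \sum_(1 <= c < y.+1)
    triple_count h X a b c = \sum_(h.+1 <= n < X.+1) dy n * dy (n - h) * dy (n + h))%N.
  rewrite [RHS](_ : _ = \sum_(h.+1 <= n < X.+1) \sum_(1 <= a < y.+1) \sum_(1 <= b < y.+1)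
      \sum_(1 <= c < y.+1) divisor_triple h a b c n)%N.
    rewrite [RHS]exchange_big; apply: eq_bigr => a _.
    rewrite [RHS]exchange_big; apply: eq_bigr => b _.
    by rewrite [RHS]exchange_big.
  apply: eq_bigr => n _; rewrite /dy !big_distrl; apply: eq_bigr => a _.
  rewrite (big_distrr (nat_of_bool _)) big_distrl; apply: eq_bigr => b _ /=.
  rewrite big_distrr; apply: eq_bigr => c _ /=.
  by rewrite /divisor_triple !mulnb andbA.
have [hX|hX] := leqP h X; last by rewrite big_geq //; lia.
rewrite [leqRHS](@big_cat_nat _ _ _ h.+1) //=.
apply: leq_trans (leq_addl _ _).
rewrite [leqRHS]big_nat_cond [leqLHS]big_nat_cond.
rewrite [leqRHS](eq_bigl (fun n => (h < n < X.+1)%N && true)); last by move=> n; lia.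
apply: leq_sum => n /andP[/andP[hn _] _].
have -> : (n - h + (h - n) = n - h)%N by lia.
by apply: leq_mul; first apply: leq_mul; apply: sum_divides_le_dnum; lia.
Qed.

Section TripleDensity.
Variables h a b c : nat.
Hypotheses (h0 : (0 < h)%N) (a0 : (0 < a)%N) (b0 : (0 < b)%N) (c0 : (0 < c)%N).

Lemma lcm3_gt0 : (0 < lcm3 a b c)%N.
Proof. by rewrite !lcmn_gt0 a0 b0 c0. Qed.

Lemma divisor_triple_residue : gcdn a b %| h -> gcdn a c %| h -> gcdn b c %| 2 * h ->
  exists z, forall n, (h < n)%N -> n = z %[mod lcm3 a b c] -> divisor_triple h a b c n.
Proof.
move=> ab ac bc.
have [z1 [z1a z1b]] : exists z, z = 0 %[mod a] /\ z = h %[mod b].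
  by apply: chinese_noncoprime => //; rewrite mod0n; apply/esym/eqP.
have {}z1a : a %| z1 by apply/eqP; rewrite z1a mod0n.
(* [h * c - h] is a natural number representing [-h] modulo [c]. *)
have hc : (h <= h * c)%N by rewrite leq_pmulr.
(* The second gluing needs [z1 + h = 0] modulo [gcdn a c], where [z1] vanishes, and modulo
   [gcdn b c], where [z1 + h = 2h]. *)
have [z [zab zc]] : exists z, z = z1 %[mod lcmn a b] /\ z = h * c - h %[mod c].
  apply: chinese_noncoprime; rewrite ?lcmn_gt0 ?a0 ?b0 //; apply/eqP.
  rewrite -(eqn_modDr h) subnK // gcdn_lcml //.
  have /eqP -> : lcmn (gcdn a c) (gcdn b c) %| h * c.
    by apply: dvdn_mull; rewrite dvdn_lcm !dvdn_gcdr.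
  rewrite -/(dvdn _ _) dvdn_lcm; apply/andP; split.
    by apply: dvdn_add ac; apply: dvdn_trans (dvdn_gcdl _ _) z1a.
  have : z1 + h = 2 * h %[mod gcdn b c].
    rewrite mul2n -addnn; apply/eqP; rewrite eqn_modDr.
    by apply/eqP; rewrite -(modn_dvdm z1 (dvdn_gcdl b c)) z1b modn_dvdm ?dvdn_gcdl.
  by rewrite /dvdn => ->.
exists z => n hn nz; apply/and3P.
have nab : n = z1 %[mod lcmn a b].
  by rewrite -zab -(modn_dvdm n (dvdn_lcml (lcmn a b) c)) nz modn_dvdm ?dvdn_lcml.
have na : n = z1 %[mod a] by rewrite -(modn_dvdm n (dvdn_lcml a b)) nab modn_dvdm ?dvdn_lcml.
have nb : n = z1 %[mod b] by rewrite -(modn_dvdm n (dvdn_lcmr a b)) nab modn_dvdm ?dvdn_lcmr.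
have nc : n = h * c - h %[mod c].
  by rewrite -zc -(modn_dvdm n (dvdn_lcmr (lcmn a b) c)) nz modn_dvdm ?dvdn_lcmr.
split; first by rewrite /dvdn na.
  by rewrite -eqn_mod_dvd ?(ltnW hn) // nb z1b.
have : n + h == h * c - h + h %[mod c] by rewrite eqn_modDr nc.
by rewrite subnK // modnMl.
Qed.

(** One residue class has at least [X %/ lcm3 a b c] members below [X]; the term [h.+1] pays for
    those in [0..h]. *)
Lemma triple_count_ge X : gcdn a b %| h -> gcdn a c %| h -> gcdn b c %| 2 * h ->
  (X %/ lcm3 a b c <= triple_count h X a b c + h.+1)%N.
Proof.
move=> ab ac bc; have [z Hz] := divisor_triple_residue ab ac bc.
apply: leq_trans (sum_eqmod_ge z X lcm3_gt0) _.
have small n : (\sum_(0 <= i < n) (i == z %[mod lcm3 a b c]) <= n)%N.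
  rewrite -[leqRHS]muln1 -[n in leqRHS]subn0 -sum_nat_const_nat; apply: leq_sum => i _.
  exact: leq_b1.
have [hX|hX] := leqP X h.+1; first by apply: leq_trans (small _) _; lia.
rewrite (@big_cat_nat _ _ _ h.+1) //= ?(ltnW hX) // addnC; apply: leq_add => //.
rewrite /triple_count big_nat_recr ?(ltnW hX) //=; apply: leq_trans _ (leq_addr _ _).
rewrite [leqLHS]big_nat_cond [leqRHS]big_nat_cond; apply: leq_sum => n /andP[/andP[hn _] _].
by case: eqP => //= E; rewrite Hz.
Qed.

End TripleDensity.

(** * Weights as densities of the counted triples *)

Definition local_compat (h p a b c : nat) : bool :=
  [&& (minn (logn p a) (logn p b) <= logn p h)%N,
      (minn (logn p a) (logn p c) <= logn p h)%N &
      (minn (logn p b) (logn p c) <= logn p (2 * h))%N].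

Lemma dvdn_logP m n : (0 < m)%N -> (0 < n)%N ->
  (forall p, prime p -> (logn p m <= logn p n)%N) -> m %| n.
Proof.
move=> m0 n0 H; have -> : m = gcdn m n; last exact: dvdn_gcdr.
apply: eqn_from_log => //; first by rewrite gcdn_gt0 m0.
move=> p; rewrite logn_gcd //; have [pp|pp] := boolP (prime p).
  by have := H p pp; lia.
by rewrite lognE (negbTE pp) min0n.
Qed.

Lemma prod_prime_logn n m : (0 < n)%N -> (n < m)%N ->
  (\prod_(0 <= p < m | prime p) p ^ logn p n)%N = n.
Proof.
case: m => // m n0 nm; rewrite -[RHS]partnT // (@widen_partn m) //.
rewrite big_mkcond [RHS]big_mkcond; apply: eq_bigr => p _ /=.
by case: (boolP (prime p)) => // pp; rewrite lognE (negbTE pp).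
Qed.

Section TripleWeight.
Variables h a b c N : nat.
Hypotheses (h0 : (0 < h)%N) (a0 : (0 < a)%N) (b0 : (0 < b)%N) (c0 : (0 < c)%N).
Hypothesis (abcN : (a * b * c < N)%N).

Lemma triple_weight_incompat p : (p < N)%N -> prime p -> ~~ local_compat h p a b c ->
  triple_weight h N a b c = 0.
Proof.
move=> pN pp ncpt; rewrite /triple_weight -big_filter (bigD1_seq p) /=.
- by rewrite /prime_weight local_weight0 //; ring.
- by rewrite mem_filter pp mem_index_iota.
- by apply: filter_uniq; apply: iota_uniq.
Qed.

(** The local factors multiply to [abc / lcm(a,b,c)], all of whose primes lie below [N] because
    [abc < N]. *)
Lemma triple_weight_compat : (forall p, prime p -> local_compat h p a b c) ->
  triple_weight h N a b c = / INR (lcm3 a b c).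
Proof.
move=> cpt; have M0 := lcm3_gt0 a0 b0 c0.
have Mabc : lcm3 a b c %| a * b * c.
  rewrite !dvdn_lcm (dvdn_mull _ (dvdnn c)) andbT.
  by apply/andP; split; apply: dvdn_mulr; [apply: dvdn_mulr|apply: dvdn_mull].
pose D := (a * b * c %/ lcm3 a b c)%N.
have DM : (D * lcm3 a b c = a * b * c)%N by apply: divnK.
have abc0 : (0 < a * b * c)%N by rewrite !muln_gt0 a0 b0 c0.
have D0 : (0 < D)%N by rewrite divn_gt0 // dvdn_leq.
have DN : (D < N)%N by apply: leq_ltn_trans abcN; apply: leq_div.
rewrite /triple_weight; have -> : \big[Rmult/1]_(0 <= p < N | prime p)
    prime_weight h p (logn p a) (logn p b) (logn p c) = INR D.
  rewrite -[in RHS](prod_prime_logn D0 DN) (big_morph INR mult_INR (erefl _)).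
  apply: eq_bigr => p pp; rewrite /prime_weight /local_weight -/(local_compat h p a b c) cpt //.
  rewrite INR_expn; congr (_ ^ _).
  by rewrite logn_div // /lcm3 !lognM ?muln_gt0 ?a0 // !logn_lcm ?lcmn_gt0 ?a0.
have nz n : (0 < n)%N -> INR n <> 0 by move=> n0; apply: not_0_INR; lia.
have E : INR a * INR b * INR c = INR D * INR (lcm3 a b c) by rewrite -!mult_INR; apply: f_equal (esym DM).
rewrite -!Rinv_mult E; field.
by split; apply: nz.
Qed.

(** In the [+ 2], one unit goes with [h] for the discarded [n <= h], the other covers the rounding
    of [x / lcm(a,b,c)]. If some prime is incompatible, the weight is 0. *)
Lemma triple_count_ge_weight X x : 0 <= x < INR X + 1 ->
  x * triple_weight h N a b c <= INR (triple_count h X a b c) + (INR h + 2).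
Proof.
move=> [x0 xX]; have rhs0 : 0 <= INR (triple_count h X a b c) + (INR h + 2).
  by have := pos_INR (triple_count h X a b c); have := pos_INR h; lra.
have [cpt|] := boolP (all (fun p => prime p ==> local_compat h p a b c) (iota 0 N)); last first.
  rewrite -has_predC => /hasP[p]; rewrite mem_iota /= negb_imply => pN /andP[pp ncpt].
  by rewrite (triple_weight_incompat pN pp ncpt) Rmult_0_r.
(* A prime [p >= N > abc] divides none of [a], [b], [c], so compatibility there is automatic. *)
have {}cpt p : prime p -> local_compat h p a b c.
  move=> pp; have [pN|pN] := ltnP p N.
    by have /allP/(_ p) := cpt; rewrite mem_iota pN pp => /(_ isT).
  have lz m : (0 < m)%N -> (m <= a * b * c)%N -> logn p m = 0%N.
    move=> m0 mabc; rewrite lognE; case: (boolP (p %| m)) => [/dvdn_leq|]; last by rewrite !andbF.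
    by move=> /(_ m0); lia.
  have al : (a <= a * b * c)%N by rewrite -mulnA leq_pmulr // muln_gt0 b0.
  have bl : (b <= a * b * c)%N by rewrite -mulnA mulnCA leq_pmulr // muln_gt0 a0.
  by rewrite /local_compat (lz a) // (lz b) // !min0n.
rewrite triple_weight_compat //; have M0 := lcm3_gt0 a0 b0 c0.
have gab : gcdn a b %| h.
  apply: dvdn_logP; rewrite ?gcdn_gt0 ?a0 // => p pp.
  by rewrite logn_gcd //; case/and3P: (cpt p pp).
have gac : gcdn a c %| h.
  apply: dvdn_logP; rewrite ?gcdn_gt0 ?a0 // => p pp.
  by rewrite logn_gcd //; case/and3P: (cpt p pp).
have gbc : gcdn b c %| 2 * h.
  apply: dvdn_logP; rewrite ?gcdn_gt0 ?b0 ?muln_gt0 // => p pp.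
  by rewrite logn_gcd //; case/and3P: (cpt p pp).
have count := triple_count_ge h0 a0 b0 c0 X gab gac gbc.
have {}count : INR (X %/ lcm3 a b c) <= INR (triple_count h X a b c) + (INR h + 1).
  by rewrite -S_INR -plus_INR; apply: le_INR; lia.
have RM0 : 0 < INR (lcm3 a b c) by apply: lt_0_INR; lia.
apply: (Rle_trans _ (INR (X %/ lcm3 a b c) + 1)); last by lra.
apply: (Rmult_le_reg_r (INR (lcm3 a b c))) => //.
rewrite Rmult_assoc Rinv_l ?Rmult_1_r; last by lra.
have : INR X + 1 <= (INR (X %/ lcm3 a b c) + 1) * INR (lcm3 a b c).
  by rewrite -!S_INR -mult_INR; apply: le_INR; have := ltn_ceil X M0; lia.
by lra.
Qed.

End TripleWeight.

(** * The constant *)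

Lemma euler_partial_decr n : 0 <= euler_partial n.+1 <= euler_partial n.
Proof.
have f01 p : prime p -> 0 <= (1 - 1 / INR p) ^ 2 * (1 + 2 / INR p) <= 1.
  move=> pp; have P2 := prime_INR_ge2 pp; rewrite /Rdiv Rmult_1_l.
  have q0 : 0 < / INR p by apply: Rinv_0_lt_compat; lra.
  have q2 : / INR p <= / 2 by apply: Rinv_le_contravar; lra.
  by split; nra.
have ge0 m : 0 <= euler_partial m by apply: rprod_ge0 => p /f01 [].
split=> //; rewrite /euler_partial big_mkcond big_nat_recr // -big_mkcond -/(euler_partial n) /=.
have := ge0 n; case: (boolP (prime n)) => [/f01|_]; last by lra.
by nra.
Qed.

(** Decreasing and bounded below, the partial products have a finite limit, so [real] does not fall
    back to its default value. *)
Lemma euler_prod_bounds n : 0 <= euler_prod <= euler_partial n.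
Proof.
have [l Hl] : ex_finite_lim_seq euler_partial.
  apply: (@ex_finite_lim_seq_decr _ 0) => m; first by have [] := euler_partial_decr m.
  by case: (euler_partial_decr m) => ? ?; lra.
have -> : euler_prod = l by rewrite /euler_prod (is_lim_seq_unique _ _ Hl).
split.
  have := @is_lim_seq_le (fun=> 0) euler_partial 0 l _ (is_lim_seq_const 0) Hl; apply => m.
  by case: (euler_partial_decr m) => ? ?; lra.
by apply: is_lim_seq_decr_compare Hl _ _ => m; have [] := euler_partial_decr m.
Qed.

Lemma fmul_ge0 h : 0 <= fmul h.
Proof. by apply: rprod_ge0 => p; apply: fpp_ge0. Qed.

Lemma triple_massE h N : (0 < h)%N -> (2 * h < N)%N ->
  triple_mass h N = 11 / 8 * fmul h * euler_partial N.
Proof.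
move=> h0 hN; rewrite /triple_mass /prime_mass big_split [X in X * _ = _]big_split -/(euler_partial N).
have -> : \big[Rmult/1]_(0 <= p < N | prime p) fpp p (logn p h) = fmul h.
  rewrite (@big_cat_nat _ _ _ h.+1) //=; last by lia.
  rewrite [X in _ * X = _]big_nat_cond [X in _ * X = _]big1 ?Rmult_1_r //.
  move=> p /andP[/andP[hp _] _]; rewrite /fpp (_ : logn p h = 0%N) //.
  by rewrite lognE; case: (boolP (p %| h)) => [/dvdn_leq|]; rewrite ?andbF //; lia.
have -> : \big[Rmult/1]_(0 <= p < N | prime p) (if p == 2%N then 11 / 8 else 1) = 11 / 8.
  rewrite (@big_cat_nat _ _ _ 3) //=; last by lia.
  rewrite [X in _ * X = _]big_nat_cond [X in _ * X = _]big1 ?Rmult_1_r.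
    by rewrite big_mkcond /index_iota /= !big_cons big_nil /=; lra.
  by move=> p /andP[/andP[hp _] _]; case: eqP => // E; lia.
by rewrite /=; ring.
Qed.

Lemma c_h_ge0 h : 0 <= c_h h.
Proof.
rewrite /c_h; apply: Rmult_le_pos; last by have [] := euler_prod_bounds 0.
by apply: Rmult_le_pos; [lra|apply: fmul_ge0].
Qed.

(** Partial products overshoot the limit, which is the right direction for a lower bound; no rate of
    convergence is required. *)
Lemma c_h_le_triple_mass h N : (0 < h)%N -> (2 * h < N)%N -> c_h h <= triple_mass h N.
Proof.
move=> h0 hN; rewrite triple_massE // /c_h; apply: Rmult_le_compat_l.
  by apply: Rmult_le_pos; [lra|apply: fmul_ge0].
by have [] := euler_prod_bounds N.
Qed.

(** * From the triple sum to the lower bound *)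

Lemma floor_nat_bounds x : 0 <= x ->
  INR (Z.to_nat (Int_part x)) <= x < INR (Z.to_nat (Int_part x)) + 1.
Proof.
move=> x0; have [lo hi] := base_Int_part x.
have z0 : (0 <= Int_part x)%Z.
  suff : (-1 < Int_part x)%Z by lia.
  by apply: lt_IZR; lra.
by rewrite INR_IZR_INZ Z2Nat.id //; lra.
Qed.

Lemma INR_sum3 s t r (F : nat -> nat -> nat -> nat) :
  INR (\sum_(1 <= a < s.+1) \sum_(1 <= b < t.+1) \sum_(1 <= c < r.+1) F a b c) =
  sum3 s t r (fun a b c => INR (F a b c)).
Proof.
rewrite INR_sum; apply: eq_bigr => a _; rewrite INR_sum; apply: eq_bigr => b _.
by rewrite INR_sum.
Qed.

Lemma rsum1 s : \rsum_(1 <= a < s.+1) 1 = INR s.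
Proof.
elim: s => [|s IH]; first by rewrite big_nil.
by rewrite big_nat_recr // IH S_INR.
Qed.

(** Each of the [y^3] triples loses at most [h + 2], and [abc <= y^3 < N] makes every weight the
    full density. *)
Lemma Ssum_ge_triple_sum h y N x : (0 < h)%N -> (y ^ 3 < N)%N -> 0 <= x ->
  x * triple_sum h N y y y - (INR h + 2) * INR y ^ 3 <= INR (Ssum h x).
Proof.
move=> h0 yN x0; have [Xlo Xhi] := floor_nat_bounds x0.
have /leP/le_INR := triple_count_le_Ssum h y x; rewrite INR_sum3; set X := Z.to_nat _.
apply: Rle_trans.
have -> : INR y ^ 3 = sum3 y y y (fun _ _ _ => 1 * 1 * 1) by rewrite sum3_mul rsum1; ring.
suff : x * triple_sum h N y y y <= sum3 y y y (fun a b c => INR (triple_count h X a b c)) +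
  (INR h + 2) * sum3 y y y (fun _ _ _ => 1 * 1 * 1) by lra.
rewrite /triple_sum -!sum3_scal -sum3_plus; apply: sum3_le => a b c.
move=> /andP[a0 ay] /andP[b0 b_y] /andP[c0 cy]; rewrite !Rmult_1_r.
apply: triple_count_ge_weight => //; apply: leq_ltn_trans yN.
by rewrite !expnS expn0 muln1 mulnA; repeat apply: leq_mul.
Qed.

Theorem theorem1p1 (h : nat) (hpos : (0 < h)%N) :
  exists (C X0 : R), forall x : R, (X0 <= x)%R ->
    (c_h h / 27 * x * ln x ^ 3 - C * x * ln x ^ 2 <= INR (Ssum h x))%R.
Proof.
have [E HE] := triple_approx_uniform hpos.
(* With [l = ln x / 3], the three summands come from replacing [m^3] by [l^3], from the error
   [E (1 + m)^2], and from the rounding; 9 converts [l^2] to [(ln x)^2]. The threshold [exp 3] gives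
   [l >= 1]. *)
exists ((3 * c_h h + 4 * E + (INR h + 2)) / 9), (exp 3) => x Xx.
have x0 : 0 < x by have := exp_pos 3; lra.
pose l := ln x / 3; pose r := exp l.
have lx : ln x = 3 * l by rewrite /l; lra.
have l1 : 1 <= l.
  suff : 3 <= ln x by rewrite /l; lra.
  by rewrite -(ln_exp 3); apply: ln_le => //; apply: exp_pos.
have r3 : r ^ 3 = x.
  rewrite -[RHS]exp_ln // lx (_ : 3 * l = l + (l + l)); last by lra.
  by rewrite !exp_plus /r; ring.
have r1 : 1 <= r by have := exp_ineq1_le l; rewrite -/r; lra.
have [ylo yhi] := @floor_nat_bounds r ltac:(lra).
move: (Z.to_nat _) ylo yhi => y ylo yhi.
have y0 : (0 < y)%N by apply/ltP/INR_lt; rewrite /=; lra.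
have y1 : 1 <= INR y by rewrite -INR_1; apply: le_INR; lia.
have y3 : INR y ^ 3 <= x by rewrite -r3; apply: pow_incr; lra.
pose m := ln (INR y).
have m_up : m <= l by rewrite -(ln_exp l); apply: ln_le; rewrite -/r; lra.
(* Since [y >= 1] and [r < y + 1], one has [y >= r / 2]; and [ln 2 <= 1]. *)
have m_lo : l - 1 <= m.
  have : ln (r / 2) <= m by apply: ln_le; lra.
  rewrite ln_div; try lra; rewrite ln_exp.
  by have := @ln_le_sub1 2 ltac:(lra); lra.
(* [N] grows with [x], so an error constant uniform in [N] is essential here. *)
pose N := (y ^ 3 + 2 * h).+1.
have hN : (2 * h < N)%N by rewrite /N; lia.
have yN : (y ^ 3 < N)%N by rewrite /N; lia.
have [E0 /(_ y 1 1 1 y0 isT isT isT)%N] := HE N hN.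
rewrite !divn1 {1 2 3}/tau INR_1 !sqrt_1 -/m => apx.
have main : c_h h * m ^ 3 - E * (1 + m) ^ 2 <= triple_sum h N y y y.
  have cK := c_h_le_triple_mass hpos hN.
  have : c_h h * m ^ 3 <= triple_mass h N * m ^ 3.
    by apply: Rmult_le_compat_r => //; apply: pow_le; lra.
  by move: apx; split_Rabs; lra.
have c0 := c_h_ge0 h; have hh := pos_INR h.
(* [(l - 1)^3 = l^3 - 3 l^2 + (3 l - 1)], and the last term is positive. *)
have cube : l ^ 3 - 3 * l ^ 2 <= m ^ 3.
  by apply: (Rle_trans _ ((l - 1) ^ 3)); [nra|apply: pow_incr; lra].
have main' : c_h h * (l ^ 3 - 3 * l ^ 2) - E * (4 * l ^ 2) <= triple_sum h N y y y.
  apply: Rle_trans main.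
  have : c_h h * (l ^ 3 - 3 * l ^ 2) <= c_h h * m ^ 3 by apply: Rmult_le_compat_l.
  have : E * (1 + m) ^ 2 <= E * (4 * l ^ 2) by apply: Rmult_le_compat_l => //; nra.
  by lra.
apply: Rle_trans (Ssum_ge_triple_sum hpos yN (Rlt_le _ _ x0)).
have : x * (c_h h * (l ^ 3 - 3 * l ^ 2) - E * (4 * l ^ 2)) <= x * triple_sum h N y y y.
  by apply: Rmult_le_compat_l => //; lra.
have : (INR h + 2) * INR y ^ 3 <= (INR h + 2) * (x * l ^ 2).
  apply: Rmult_le_compat_l; first by lra.
  have : 1 <= l ^ 2 by nra.
  by nra.
rewrite lx.
have -> : c_h h / 27 * x * (3 * l) ^ 3 -
  (3 * c_h h + 4 * E + (INR h + 2)) / 9 * x * (3 * l) ^ 2 =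
  x * (c_h h * (l ^ 3 - 3 * l ^ 2) - E * (4 * l ^ 2)) - (INR h + 2) * (x * l ^ 2) by field.
by lra.
Qed.
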